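(* Let $n\ge1$. Every finitely generated extension $\mathcal{L}$ of $\mathrm{BD}_1$ with the $n$-PCP is the smallest among the extensions of $\mathrm{BD}_1$ with the $n$-PCP which validate a certain finite set of finitary rules.
   Context: Formulas are built from variables using $\wedge,\vee,\neg$. A structure is a pair $\langle\mathbf{A},F\rangle$, $F\subseteq A$; a rule $\Gamma\vdash\varphi$ is valid in it if every homomorphism $v$ from the formula algebra with $v[\Gamma]\subseteq F$ has $v(\varphi)\in F$. A logic is a substitution-invariant consequence relation; a finitely generated logic is one determined by a finite set of finite structures; a finitary rule has finitely many premises. $\mathrm{BD}_1$ (Belnap–Dunn logic) is the logic determined by all $\langle\mathbf{A},F\rangle$ with $\mathbf{A}$ a De~Morgan lattice (distributive lattice with $\neg$, $\neg\neg x=x$, De~Morgan laws) and $F$ a lattice filter. $\mathcal{L}$ has the $n$-PCP if for all $\Gamma,\varphi_1,\dots,\varphi_{n+1},\psi$: whenever $\Gamma,\bigvee_{j\ne i}\varphi_j\vdash_{\mathcal{L}}\psi$ for each $i\in\{1,\dots,n+1\}$, then $\Gamma,\varphi_1\vee\dots\vee\varphi_{n+1}\vdash_{\mathcal{L}}\psi$. *)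

(* Defs.v *)
From mathcomp Require Import all_boot.
From mathcomp Require Import boolp classical_sets functions cardinality.

Set Implicit Arguments.
Unset Strict Implicit.
Unset Printing Implicit Defensive.

Local Open Scope classical_set_scope.

(* Algebras in the signature (meet, join, neg); no equations are assumed. *)
Record algebra := Algebra {
  carrier :> Type;
  ameet : carrier -> carrier -> carrier;
  ajoin : carrier -> carrier -> carrier;
  aneg : carrier -> carrier;
  alg_nonempty : inhabited carrier }.

Definition homomorphism (A B : algebra) (f : A -> B) : Prop :=
  [/\ forall x y, f (ameet x y) = ameet (f x) (f y),
      forall x y, f (ajoin x y) = ajoin (f x) (f y) &
      forall x, f (aneg x) = aneg (f x)].

Inductive formula :=
  | Var of nat
  | And of formula & formula
  | Or of formula & formula
  | Neg of formula.

Definition formula_algebra : algebra :=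
  @Algebra formula And Or Neg (inhabits (Var 0)).

Record structure := Structure {
  str_alg :> algebra;
  designated : set str_alg }.

Definition valid (M : structure) (Gamma : set formula) (phi : formula) : Prop :=
  forall v : formula_algebra -> M, homomorphism v ->
    v @` Gamma `<=` designated (s := M) -> designated (v phi).

Record logic := Logic {
  entails :> set formula -> formula -> Prop;
  entails_refl : forall (Gamma : set formula) phi, Gamma phi -> entails Gamma phi;
  entails_mono : forall (Gamma Delta : set formula) phi,
    Gamma `<=` Delta -> entails Gamma phi -> entails Delta phi;
  entails_cut : forall (Gamma Delta : set formula) phi,
    (forall delta, Delta delta -> entails Gamma delta) ->
    entails Delta phi -> entails Gamma phi;
  entails_subst : forall sigma : formula_algebra -> formula_algebra,
    homomorphism sigma -> forall (Gamma : set formula) phi,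
    entails Gamma phi -> entails (sigma @` Gamma) (sigma phi) }.

Section LogicOf.
Variable K : set structure.

Definition valid_in_all (Gamma : set formula) (phi : formula) : Prop :=
  forall M, K M -> valid M Gamma phi.

Lemma valid_in_all_refl (Gamma : set formula) phi :
  Gamma phi -> valid_in_all Gamma phi.
Proof. by move=> Gphi M _ v _; apply; exists phi. Qed.

Lemma valid_in_all_mono (Gamma Delta : set formula) phi :
  Gamma `<=` Delta -> valid_in_all Gamma phi -> valid_in_all Delta phi.
Proof.
move=> sGD GP M KM v hv vD; apply: (GP M KM v hv) => _ [x Gx <-].
by apply: vD; exists x => //; apply: sGD.
Qed.

Lemma valid_in_all_cut (Gamma Delta : set formula) phi :
  (forall delta, Delta delta -> valid_in_all Gamma delta) ->
  valid_in_all Delta phi -> valid_in_all Gamma phi.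
Proof.
move=> GD DP M KM v hv vG; apply: (DP M KM v hv) => _ [x Dx <-].
exact: (GD x Dx M KM v hv vG).
Qed.

Lemma valid_in_all_subst (sigma : formula_algebra -> formula_algebra) :
  homomorphism sigma -> forall (Gamma : set formula) phi,
  valid_in_all Gamma phi -> valid_in_all (sigma @` Gamma) (sigma phi).
Proof.
move=> [sm sj sn] Gamma phi GP M KM v [vm vj vn] vG.
apply: (GP M KM (fun x => v (sigma x))).
  by split=> [x y|x y|x]; rewrite ?sm ?sj ?sn ?vm ?vj ?vn.
by move=> _ [x Gx <-]; apply: vG; exists (sigma x) => //; exists x.
Qed.

Definition logic_of : logic :=
  @Logic valid_in_all valid_in_all_refl valid_in_all_mono valid_in_all_cut
    valid_in_all_subst.

End LogicOf.

Definition extension_of (L0 L : logic) : Prop :=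
  forall Gamma phi, L0 Gamma phi -> L Gamma phi.

Definition finite_structure (M : structure) : Prop := finite_set [set: M].

Definition finitely_generated (L : logic) : Prop :=
  exists K : set structure,
    [/\ finite_set K,
        forall M, K M -> finite_structure M &
        forall Gamma phi, L Gamma phi <-> logic_of K Gamma phi].

Record De_Morgan_lattice (A : algebra) : Prop := DeMorganLattice {
  dm_meetC : forall x y : A, ameet x y = ameet y x;
  dm_joinC : forall x y : A, ajoin x y = ajoin y x;
  dm_meetA : forall x y z : A, ameet x (ameet y z) = ameet (ameet x y) z;
  dm_joinA : forall x y z : A, ajoin x (ajoin y z) = ajoin (ajoin x y) z;
  dm_meetK : forall x y : A, ameet x (ajoin x y) = x;
  dm_joinK : forall x y : A, ajoin x (ameet x y) = x;
  dm_meetU : forall x y z : A,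
    ameet x (ajoin y z) = ajoin (ameet x y) (ameet x z);
  dm_negK : forall x : A, aneg (aneg x) = x;
  dm_negI : forall x y : A, aneg (ameet x y) = ajoin (aneg x) (aneg y);
  dm_negU : forall x y : A, aneg (ajoin x y) = ameet (aneg x) (aneg y) }.

(* [ameet x y = x] is the lattice order x <= y. Requiring filters to be
   nonempty does not affect BD1: it has no theorems either way, and a rule with
   at least one premise is valid whenever the designated set is empty. *)
Definition lattice_filter (A : algebra) (F : set A) : Prop :=
  [/\ F !=set0,
      forall x y, F x -> ameet x y = x -> F y &
      forall x y, F x -> F y -> F (ameet x y)].

Definition BD1 : logic :=
  logic_of [set M : structure |
    De_Morgan_lattice M /\ lattice_filter (designated (s := M))].

(* The value on the empty list is junk. *)
Fixpoint bigOr (s : seq formula) : formula :=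
  match s with
  | [::] => Var 0
  | [:: phi] => phi
  | phi :: s' => Or phi (bigOr s')
  end.

(* [bigOr] is only applied to nonempty lists when 0 < n. *)
Definition PCP (n : nat) (L : logic) : Prop :=
  forall (Gamma : set formula) (phi : 'I_n.+1 -> formula) (psi : formula),
    (forall i : 'I_n.+1,
       L (Gamma `|` [set bigOr [seq phi j | j <- enum 'I_n.+1 & j != i]]) psi) ->
    L (Gamma `|` [set bigOr [seq phi j | j <- enum 'I_n.+1]]) psi.

Definition rule : Type := set formula * formula.

Definition finitary (r : rule) : Prop := finite_set r.1.

Definition validates (L : logic) (R : set rule) : Prop :=
  forall r, R r -> L r.1 r.2.

Definition smallest_logic (C : set logic) (L : logic) : Prop :=
  C L /\ forall L', C L' -> extension_of L L'.

(* Main.v *)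
Require Import Defs.
From mathcomp Require Import all_boot finmap.
From mathcomp Require Import boolp classical_sets cardinality filter.

Set Implicit Arguments.
Unset Strict Implicit.
Unset Printing Implicit Defensive.

Local Open Scope classical_set_scope.

(** Let L' extend BD1 and have the n-PCP, and let psi not follow from Gamma in
    the finitary part of L'. By Zorn's lemma Gamma extends to a set T maximal
    among those from which psi does not follow; T is a theory, and it is n-prime
    by the n-PCP. An n-prime filter is an intersection of n prime filters: if k
    is least such that the filter is k-prime, some join of k elements lies in
    it, but no join of fewer of them does, and the elements whose join with all
    but the i-th of them lies in the filter form the i-th prime filter. A prime
    filter of formulas is the preimage of the designated values under a
    homomorphism to the four-element De Morgan lattice DM4. So T is the preimage
    of the designated values under a homomorphism h to DM4^n, and since
    valuations in the image of h lift to substitutions, all finitary rules of L'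
    are valid in this image. Hence the finitary part of L' is determined by a
    set of substructures of DM4^n, of which there are finitely many. As L is
    finitary, it suffices to put in R one finitary rule of L for each subset of
    DM4^n that refutes such a rule. *)

(** * n-prime filters *)

Definition upper_bounds (X I : Type) (R : X -> X -> Prop) (phi : I -> X)
  (D : set I) : set X := [set u | forall i, D i -> R (phi i) u].

Lemma directed_upper_bound (X I : Type) (R : X -> X -> Prop) (K : set X)
    (phi : I -> X) (D : set I) :
  (forall y x z, R x y -> R y z -> R x z) -> K !=set0 ->
  (forall x y, K x -> K y -> exists2 z, K z & R x z /\ R y z) ->
  finite_set D -> (forall i, D i -> K (phi i)) ->
  exists2 t, K t & upper_bounds R phi D t.
Proof.
elim/Pchoice: I => I in phi D * => R_trans [x0 Kx0] Kdir /finite_seqP[s ->].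
elim: s => [|i s IHs] sK; first by exists x0.
have [|t Kt st] := IHs; first by move=> j js; apply: sK; rewrite /= inE js orbT.
have [|u Ku [iu tu]] := Kdir (phi i) t _ Kt; first exact/sK/mem_head.
exists u => // j; rewrite /= in_cons => /predU1P[->//|/st jt].
exact: R_trans tu.
Qed.

(* Distributive lattices up to equivalence, so that formulas can be handled
   without passing to the Lindenbaum algebra. *)
Record distr_prelattice (X : Type) (le : X -> X -> Prop)
    (meet join : X -> X -> X) : Prop := DistrPrelattice {
  prele_refl : forall x, le x x;
  prele_trans : forall y x z, le x y -> le y z -> le x z;
  prele_meetP : forall x y z, le z (meet x y) <-> le z x /\ le z y;
  prele_joinP : forall x y z, le (join x y) z <-> le x z /\ le y z;
  prele_meetU : forall x y z,
    le (meet x (join y z)) (join (meet x y) (meet x z)) }.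

Section Filters.
Variables (X : Type) (le : X -> X -> Prop) (meet join : X -> X -> X).

Record meet_filter (F : set X) : Prop := MeetFilter {
  filter_up : forall x y, F x -> le x y -> F y;
  filter_meet : forall x y, F x -> F y -> F (meet x y) }.

Record prime_filter (F : set X) : Prop := PrimeFilter {
  prime_meet_filter :> meet_filter F;
  prime_join : forall x y, F (join x y) -> F x \/ F y }.

(* If the family has a join, its upper bounds all lie in the filter F if and
   only if the join does. The empty family, which matters for n = 0, need not
   have one. *)
Definition nprime (n : nat) (F : set X) : Prop :=
  forall phi : 'I_n.+1 -> X, upper_bounds le phi setT `<=` F ->
    exists i, upper_bounds le phi [set~ i] `<=` F.

Lemma nprime_bij n F (I : Type) (e : 'I_n.+1 -> I) (phi : I -> X) :
  bijective e -> nprime n F -> upper_bounds le phi setT `<=` F ->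
  exists i, upper_bounds le phi [set~ i] `<=` F.
Proof.
move=> [e' eK e'K] Fn sF; have [u ub|i sFi] := Fn (phi \o e).
  by apply: sF => i _; rewrite -(e'K i); apply: ub.
exists (e i) => u ub; apply: sFi => j /= ji; apply: ub => /(can_inj eK).
exact: ji.
Qed.

Lemma nprime_option n F (phi : option 'I_n.+1 -> X) :
  nprime n.+1 F -> upper_bounds le phi setT `<=` F ->
  upper_bounds le phi [set~ None] `<=` F \/
  exists i, upper_bounds le phi [set~ Some i] `<=` F.
Proof.
move=> Fn sF; have e_bij : bijective (unlift (@ord0 n.+1)).
  exists (oapp (lift ord0) ord0) => [i|[i|]].
  - by case: unliftP => [j ->|->].
  - exact: liftK.
  - exact: unlift_none.
by have [[i|] sFi] := nprime_bij e_bij Fn sF; [right; exists i|left].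
Qed.

Hypothesis latX : distr_prelattice le meet join.
Let le_refl := prele_refl latX.
Let le_trans := prele_trans latX.

Lemma prele_meetl x y z : le x z -> le (meet x y) z.
Proof.
by apply: le_trans; have [] := (prele_meetP latX x y _).1 (le_refl _).
Qed.

Lemma prele_meetr x y z : le y z -> le (meet x y) z.
Proof.
by apply: le_trans; have [] := (prele_meetP latX x y _).1 (le_refl _).
Qed.

Lemma prele_joinl x y z : le z x -> le z (join x y).
Proof.
by move/le_trans; apply; have [] := (prele_joinP latX x y _).1 (le_refl _).
Qed.

Lemma prele_joinr x y z : le z y -> le z (join x y).
Proof.
by move/le_trans; apply; have [] := (prele_joinP latX x y _).1 (le_refl _).
Qed.

Lemma prele_meet_join x y z u :
  le (meet x y) u -> le (meet x z) u -> le (meet x (join y z)) u.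
Proof.
move=> xy xz; apply: le_trans (prele_meetU latX _ _ _) _.
by apply/(prele_joinP latX).
Qed.

Lemma filter_meetP F x y : meet_filter F -> F (meet x y) <-> F x /\ F y.
Proof.
move=> FF; split=> [Fxy|[Fx Fy]]; last exact: filter_meet.
by split; apply: (filter_up FF Fxy); [apply: prele_meetl|apply: prele_meetr].
Qed.

Lemma prime_joinP F x y : prime_filter F -> F (join x y) <-> F x \/ F y.
Proof.
move=> FF; split=> [|[Fx|Fy]]; first exact: prime_join.
- by apply: (filter_up FF Fx); apply: prele_joinl.
- by apply: (filter_up FF Fy); apply: prele_joinr.
Qed.

Lemma filter_resolution F x y z : meet_filter F -> le (meet x y) z ->
  F (join z x) -> F (join z y) -> F z.
Proof.
move=> FF xyz Fzx Fzy; apply: (filter_up FF (filter_meet FF Fzx Fzy)).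
have meetC a b : le (meet a b) (meet b a).
  by apply/(prele_meetP latX); split; [apply: prele_meetr|apply: prele_meetl].
apply: prele_meet_join; first exact: prele_meetr.
apply: le_trans (meetC _ _) _; apply: prele_meet_join; first exact: prele_meetr.
exact: le_trans (meetC _ _) xyz.
Qed.

Lemma filter_joinI F x y z : meet_filter F ->
  F (join z x) -> F (join z y) -> F (join z (meet x y)).
Proof.
move=> FF Fzx Fzy; have joinK t : le (join z t) (join (join z (meet x y)) t).
  apply/(prele_joinP latX).
  by split; [do 2!apply: prele_joinl|apply: prele_joinr].
apply: (filter_resolution FF (prele_joinr _ (le_refl (meet x y)))).
- exact: filter_up FF _ _ Fzx (joinK x).
- exact: filter_up FF _ _ Fzy (joinK y).
Qed.

Definition irredundant (F : set X) n (phi : 'I_n.+1 -> X) : Prop :=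
  upper_bounds le phi setT `<=` F /\
  forall i, ~ upper_bounds le phi [set~ i] `<=` F.

(* x belongs to [residual F phi i] if the join of x and all phi j with j != i
   lies in F. *)
Definition residual (F : set X) n (phi : 'I_n.+1 -> X) i : set X :=
  [set x | forall u, le x u -> upper_bounds le phi [set~ i] u -> F u].

Section Residual.
Variables (n : nat) (F : set X) (phi : 'I_n.+1 -> X).
Hypotheses (filterF : meet_filter F) (nprimeF : nprime n.+1 F).
Hypothesis phi_irr : irredundant F phi.

Lemma residual_filter i : meet_filter (residual F phi i).
Proof.
split=> [x y xF xy u yu|x y xF yF u xyu uP].
  by apply: xF; apply: le_trans yu.
apply: (filter_resolution filterF xyu); [apply: xF|apply: yF];
  by [apply: prele_joinr | move=> j /uP ju; apply: prele_joinl].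
Qed.

Lemma residual_prime i : prime_filter (residual F phi i).
Proof.
split=> [|x y xyF]; first exact: residual_filter.
pose f o := if o is Some j then (if j == i then meet (phi i) x else phi j)
            else meet (phi i) y.
(* The join of f is the meet of phi i \/ d and x \/ y \/ d, both in F, where d
   is the join of the phi j with j != i. *)
have [z zf|sF|[j sF]] := @nprime_option _ F f nprimeF.
- have zphi j : j != i -> le (phi j) z.
    by move=> /negPf ji; have := zf (Some j) I; rewrite /f ji.
  apply: (@filter_resolution _ (phi i) (join x y)) => //.
  + apply: prele_meet_join; last exact: zf None I.
    by have := zf (Some i) I; rewrite /f eqxx.
  + apply: phi_irr.1 => j _; have [->|/zphi] := eqVneq j i.
      exact: prele_joinr.
    exact: prele_joinl.
  + by apply: xyF; [apply: prele_joinr|move=> j /eqP/zphi; apply: prele_joinl].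
- left=> u xu uP; apply: sF => -[j _|/(_ erefl)//].
  rewrite /f; case: eqP => [_|ji]; [exact: prele_meetr|exact: uP].
- case: (eqVneq j i) sF => [->{j}|ji] sF.
    right=> u yu uP; apply: sF => -[l li|_]; last exact: prele_meetr.
    by rewrite /f; case: eqP => [eli|/uP//]; case: li; rewrite eli.
  case: (phi_irr.2 j) => u uP; apply: sF.
  have phi_i : le (phi i) u by apply/uP/nesym/eqP.
  case=> [l lj|_]; last exact: prele_meetl.
  rewrite /f; case: eqP => [_|_]; first exact: prele_meetl.
  by apply: uP => elj; case: lj; rewrite elj.
Qed.

Lemma residual_bigcap x : (forall i, residual F phi i x) -> F x.
Proof.
move=> xF; have /choice[u uP] i := nonsubset (phi_irr.2 i).
have [c Fxc cu] : exists2 c, F (join x c)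
    & upper_bounds (fun a b => le b a) u setT c.
  have Fxu i : F (join x (u i)).
    by apply: xF => [|j /(uP i).1]; [apply: prele_joinl|apply: prele_joinr].
  apply: (@directed_upper_bound _ _ _ [set c | F (join x c)]) => //.
  - by move=> b a c ba cb; apply: le_trans ba.
  - by exists (u ord0); apply: Fxu.
  - move=> a b Fxa Fxb; exists (meet a b); first exact: filter_joinI.
    by split; [apply: prele_meetl|apply: prele_meetr].
  - by move=> i _; apply: Fxu.
pose f o := if o is Some j then meet x (phi j) else c.
(* The join of f is above the meet of x \/ c and the join of phi, both in F. *)
have [z zf|sF|[i sF]] := @nprime_option _ F f nprimeF.
- have [t xt tP] : exists2 t, le (meet x t) z & upper_bounds le phi setT t.
    apply: (@directed_upper_bound _ _ _ [set t | le (meet x t) z]) => //.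
    + by exists (phi ord0); apply: zf (Some ord0) I.
    + move=> a b xa xb; exists (join a b); first exact: prele_meet_join.
      by split; [apply: prele_joinl|apply: prele_joinr].
    + by move=> i _; apply: zf (Some i) I.
  apply: (filter_resolution filterF xt).
    apply: (filter_up filterF Fxc); apply/(prele_joinP latX).
    by split; [apply: prele_joinr|apply/prele_joinl/(zf None)].
  by apply: phi_irr.1 => i _; apply/prele_joinr/tP.
- by apply: sF => -[i _|/(_ erefl)//]; apply: prele_meetl.
- case: (uP i) => ub; case; apply: sF => -[j ji|_]; last exact: (cu i I).
  by apply/prele_meetr/ub => ij; apply: ji; rewrite ij.
Qed.

End Residual.

Theorem nprime_decomposition n (F : set X) :
  0 < n -> meet_filter F -> nprime n F ->
  exists2 P : 'I_n -> set X,
    forall i, prime_filter (P i) & forall x, F x <-> forall i, P i x.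
Proof.
move=> n_gt0 filterF.
have [[x0 Fx0]|/forallNP F0] := pselect (F !=set0); last first.
  move=> _; exists (fun=> F) => [_|x]; last by split=> // /(_ (Ordinal n_gt0)).
  by split=> [|x y /F0//]; split=> x y /F0.
elim: n {n_gt0} => [|n IHn] nprimeF.
  exists (fun=> F) => [[]//|x]; split=> // _.
  have [u /(_ ord0 I)|i sF] := nprimeF (fun=> x0).
    exact: (filter_up filterF Fx0).
  by apply: sF => j; rewrite (ord1 i) (ord1 j) => /(_ erefl).
have [/IHn[P primeP FP]|/existsNP[phi /not_implyP[phiF /forallNP phi_irr]]] :=
  pselect (nprime n F).
  exists (fun i => if unlift ord0 i is Some j then P j else setT) => [i|x].
    case: unlift => [j|]; first exact: primeP.
    by split=> [|x y _]; [split|left].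
  split=> [/FP Px i|Px]; first by case: unlift.
  by apply/FP => j; have := Px (lift ord0 j); rewrite liftK.
exists (residual F phi) => [i|x]; first exact: residual_prime.
split=> [Fx i u xu _|]; first exact: (filter_up filterF Fx).
exact: residual_bigcap.
Qed.

End Filters.

(** * Prime filters of formulas *)

Lemma De_Morgan_prelattice (A : algebra) : De_Morgan_lattice A ->
  distr_prelattice (fun x y : A => ameet x y = x) (@ameet A) (@ajoin A).
Proof.
move=> dmA; have meetxx (x : A) : ameet x x = x.
  by rewrite -{2}(dm_joinK dmA x x) dm_meetK.
split=> [x|y x z xy yz|x y z|x y z|x y z]; first exact: meetxx.
- by rewrite -xy -(dm_meetA dmA) yz.
- split=> [<-|[zx zy]]; last by rewrite (dm_meetA dmA) zx.
  split; last by rewrite -!(dm_meetA dmA) meetxx.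
  by rewrite (dm_meetC dmA x) -!(dm_meetA dmA) meetxx.
- split=> [xyz|[xz yz]]; last first.
    by rewrite (dm_meetC dmA) (dm_meetU dmA) !(dm_meetC dmA z) xz yz.
  split; last rewrite (dm_joinC dmA) in xyz.
    by rewrite -{1}(dm_meetK dmA x y) -(dm_meetA dmA) xyz (dm_meetK dmA).
  by rewrite -{1}(dm_meetK dmA y x) -(dm_meetA dmA) xyz (dm_meetK dmA).
- by rewrite -(dm_meetU dmA) meetxx.
Qed.

Definition dm_le (a b : formula) : Prop :=
  forall (A : algebra) (v : formula_algebra -> A),
    De_Morgan_lattice A -> homomorphism v -> ameet (v a) (v b) = v a.

Lemma dm_le_prelattice : distr_prelattice dm_le And Or.
Proof.
split=> [a|b a c ab bc|a b c|a b c|a b c].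
- by move=> A v /De_Morgan_prelattice/prele_refl.
- move=> A v dmA v_hom; apply: (prele_trans (De_Morgan_prelattice dmA)).
    exact: ab.
  exact: bc.
- split=> [cab|[ca cb] A v dmA v_hom].
    by split=> A v dmA v_hom; have [vI _ _] := v_hom; have := cab A v dmA v_hom;
      rewrite vI => /(prele_meetP (De_Morgan_prelattice dmA))[].
  have [-> _ _] := v_hom; apply/(prele_meetP (De_Morgan_prelattice dmA)).
  by split; [apply: ca|apply: cb].
- split=> [abc|[ac bc] A v dmA v_hom].
    by split=> A v dmA v_hom; have [_ vU _] := v_hom; have := abc A v dmA v_hom;
      rewrite vU => /(prele_joinP (De_Morgan_prelattice dmA))[].
  have [_ -> _] := v_hom; apply/(prele_joinP (De_Morgan_prelattice dmA)).
  by split; [apply: ac|apply: bc].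
- move=> A v dmA [vI vU _]; rewrite !(vI, vU).
  exact: prele_meetU (De_Morgan_prelattice dmA) _ _ _.
Qed.

Definition dm_eq (a b : formula) : Prop :=
  forall (A : algebra) (v : formula_algebra -> A),
    De_Morgan_lattice A -> homomorphism v -> v a = v b.

Lemma dm_eq_le a b : dm_eq a b -> dm_le a b /\ dm_le b a.
Proof.
move=> ab; split=> A v dmA v_hom; rewrite (ab A v dmA v_hom);
  exact: prele_refl (De_Morgan_prelattice dmA) _.
Qed.

Lemma BD1_dm_le (a b : formula) : dm_le a b -> BD1 [set a] b.
Proof.
move=> ab M [dmM [_ up _]] v v_hom va; apply: up (ab M v dmM v_hom).
by apply: va; exists a.
Qed.

Lemma BD1_And (a b : formula) : BD1 [set a; b] (And a b).
Proof.
move=> M [_ [_ _ FI]] v [vI _ _] vab; rewrite vI.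
by apply: FI; apply: vab; [exists a; [left|]|exists b; [right|]].
Qed.

Lemma dm_le_bigOr (I : eqType) (s : seq I) (phi : I -> formula) i :
  i \in s -> dm_le (phi i) (bigOr [seq phi j | j <- s]).
Proof.
elim: s => // j [|k s] IHs; rewrite in_cons => /predU1P[->|] //=.
- exact: (prele_refl dm_le_prelattice).
- exact/(prele_joinl dm_le_prelattice)/(prele_refl dm_le_prelattice).
- by move=> /IHs; apply: (prele_joinr dm_le_prelattice).
Qed.

Lemma bigOr_dm_le (I : eqType) (s : seq I) (phi : I -> formula) u :
  s != [::] -> {in s, forall i, dm_le (phi i) u} ->
  dm_le (bigOr [seq phi j | j <- s]) u.
Proof.
elim: s => // j [|k s] IHs _ su /=; first exact: su (mem_head _ _).
apply/(prele_joinP dm_le_prelattice); split; first exact: su (mem_head _ _).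
by apply: IHs => // i si; apply: su; rewrite inE si orbT.
Qed.

(* The two coordinates of a value say whether it and its negation hold. *)
Definition DM4 : structure :=
  @Structure
    (@Algebra (bool * bool) (fun x y => (x.1 && y.1, x.2 || y.2))
       (fun x y => (x.1 || y.1, x.2 && y.2)) (fun x => (x.2, x.1))
       (inhabits (true, true)))
    [set x : bool * bool | x.1].

Definition prime_map (P : set formula) (a : formula_algebra) : DM4 :=
  (`[< P a >], `[< P (Neg a) >]).

Lemma prime_map_hom (P : set formula) :
  prime_filter dm_le And Or P -> homomorphism (prime_map P).
Proof.
move=> primeP; have filterP := prime_meet_filter primeP.
have P_eq a b : dm_eq a b -> P a = P b.
  move=> /dm_eq_le[ab ba]; apply/propext.
  by split=> /(filter_up filterP); apply.
have PI a b : P (And a b) = (P a /\ P b).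
  exact/propext/(filter_meetP dm_le_prelattice).
have PU a b : P (Or a b) = (P a \/ P b).
  exact/propext/(prime_joinP dm_le_prelattice).
have PNI a b : P (Neg (And a b)) = (P (Neg a) \/ P (Neg b)).
  rewrite -PU; apply: P_eq => A v dmA [vI vU vN].
  by rewrite vN vI vU !vN (dm_negI dmA).
have PNU a b : P (Neg (Or a b)) = (P (Neg a) /\ P (Neg b)).
  rewrite -PI; apply: P_eq => A v dmA [vI vU vN].
  by rewrite vN vI vU !vN (dm_negU dmA).
have PNN a : P (Neg (Neg a)) = P a.
  by apply: P_eq => A v dmA [_ _ vN]; rewrite !vN (dm_negK dmA).
by split=> [a b|a b|a]; rewrite /prime_map /= ?PI ?PU ?PNI ?PNU ?PNN
  ?asbool_and ?asbool_or.
Qed.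

Lemma nprime_DM4_preimage n (T : set formula) :
  0 < n -> meet_filter dm_le And T -> nprime dm_le n T ->
  exists2 h : 'I_n -> formula_algebra -> DM4,
    forall i, homomorphism (h i) &
    T = [set a | forall i, designated (s := DM4) (h i a)].
Proof.
move=> n_gt0 filterT nprimeT.
have [P primeP TP] :=
  nprime_decomposition dm_le_prelattice n_gt0 filterT nprimeT.
exists (prime_map \o P) => [i|]; first exact: prime_map_hom.
by apply/seteqP; split=> a; rewrite TP => Pa i; apply/asboolP/Pa.
Qed.

(** * Maximal theories of finitary logics *)

Section FinitaryPart.
Variable L : logic.

Definition finitary_entails (Gamma : set formula) (a : formula) : Prop :=
  exists Delta, [/\ finite_set Delta, Delta `<=` Gamma & L Delta a].

Lemma finitary_entails_refl (Gamma : set formula) a :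
  Gamma a -> finitary_entails Gamma a.
Proof.
move=> Ga; exists [set a]; split; [exact: finite_set1|by move=> _ ->|].
exact: entails_refl.
Qed.

Lemma finitary_entails_mono (Gamma Delta : set formula) a :
  Gamma `<=` Delta -> finitary_entails Gamma a -> finitary_entails Delta a.
Proof.
by move=> GD [E [finE EG Ea]]; exists E; split=> //; apply: subset_trans GD.
Qed.

Lemma finitary_entails_cut (Gamma Delta : set formula) a :
  (forall d, Delta d -> finitary_entails Gamma d) ->
  finitary_entails Delta a -> finitary_entails Gamma a.
Proof.
move=> GD [D [finD DDelta Da]].
have /choice[E hE] d : exists E, D d ->
    [/\ finite_set E, E `<=` Gamma & L E d].
  have [/DDelta/GD[E hE]|nDd] := pselect (D d); first by exists E.
  by exists set0.
exists (\bigcup_(d in D) E d); split.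
- by apply: bigcup_finite => // d /hE[].
- by apply: bigcup_sub => d /hE[].
- apply: entails_cut Da => d Dd; have [_ _] := hE d Dd.
  by apply: entails_mono; apply: bigcup_sup.
Qed.

Lemma finitary_entails_subst (sigma : formula_algebra -> formula_algebra) :
  homomorphism sigma -> forall (Gamma : set formula) a,
  finitary_entails Gamma a -> finitary_entails (sigma @` Gamma) (sigma a).
Proof.
move=> sigma_hom Gamma a [D [finD DG Da]]; exists (sigma @` D); split.
- exact: finite_image.
- exact: image_subset.
- exact: entails_subst.
Qed.

Definition finitary_part : logic :=
  @Logic finitary_entails finitary_entails_refl finitary_entails_mono
    finitary_entails_cut finitary_entails_subst.

End FinitaryPart.

Definition finitary_logic (L : logic) : Prop :=
  extension_of L (finitary_part L).

Lemma finitary_part_sub (L : logic) : extension_of (finitary_part L) L.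
Proof. by move=> Gamma a [D [_ DG]]; apply: entails_mono. Qed.

Lemma finitary_finitary_part (L : logic) : finitary_logic (finitary_part L).
Proof.
by move=> Gamma a [D [finD DG Da]]; exists D; split=> //; exists D; split.
Qed.

Lemma finitary_part_extension (L0 L : logic) :
  extension_of L0 L -> extension_of (finitary_part L0) (finitary_part L).
Proof. by move=> L0L Gamma a [D [finD DG /L0L Da]]; exists D. Qed.

Lemma PCP_finitary_part n (L : logic) : PCP n L -> PCP n (finitary_part L).
Proof.
move=> L_PCP Gamma phi a.
set all := bigOr _.
pose but i := bigOr [seq phi j | j <- enum 'I_n.+1 & j != i].
move=> /choice[D hD]; pose E := \bigcup_(i in setT) (D i `\ but i).
exists (E `|` [set all]); split.
- rewrite finite_setU; split; last exact: finite_set1.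
  by apply: bigcup_finite => // i _; apply: finite_setD; have [] := hD i.
- move=> d [[i _ [Dd nd]]|->]; last by right.
  by have [_ /(_ d Dd)[Gd|//]] := hD i; left.
- apply: L_PCP => i; have [_ _] := hD i; apply: entails_mono => d Dd.
  by have [->|nd] := pselect (d = but i); [right|left; exists i].
Qed.

Definition theory (L : logic) (T : set formula) : Prop :=
  forall a, L T a -> T a.

Definition relatively_maximal (L : logic) (a : formula) (T : set formula) :=
  ~ L T a /\ forall b, ~ T b -> L (T `|` [set b]) a.

Lemma finite_sub_chain (X : Type) (F : set (set X)) (D : set X) :
  total_on F subset -> F !=set0 -> finite_set D -> D `<=` \bigcup_(Y in F) Y ->
  exists2 Y, F Y & D `<=` Y.
Proof.
move=> totF [Y0 FY0] finD DF.
have /choice[f fP] x : exists Y, F Y /\ (D x -> Y x).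
  have [/DF[Y FY Yx]|nDx] := pselect (D x); first by exists Y.
  by exists Y0.
have [||||x Dx|Y FY fY] := @directed_upper_bound _ _ subset F f D.
- by move=> B A C; apply: subset_trans.
- by exists Y0.
- move=> A B FA FB; have [AB|BA] := totF A B FA FB.
    by exists B; last split.
  by exists A; last split.
- exact: finD.
- by have [] := fP x.
- by exists Y => // x Dx; apply/(fY x Dx)/(fP x).2.
Qed.

Lemma relatively_maximal_exists (L : logic) (Gamma : set formula) a :
  finitary_logic L -> ~ L Gamma a ->
  exists2 T, Gamma `<=` T & relatively_maximal L a T.
Proof.
move=> finL nGa; pose avoids X := ~ L (Gamma `|` X) a.
have [F sF totF|T [avT maxT]] := @Zorn_bigcup _ avoids.
  have [F0|/set0P/negP/negPn/eqP->] := pselect (F !=set0); last first.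
    by rewrite /avoids bigcup_set0 setU0.
  rewrite /avoids -bigcupUr // => /finL[D [finD DF Da]].
  have [||||_ [Y FY <-] DY] :=
    @finite_sub_chain _ [set Gamma `|` Y | Y in F] D.
  - move=> _ _ [Y FY <-] [Z FZ <-].
    by have [YZ|ZY] := totF Y Z FY FZ; [left|right]; apply: setUS.
  - exact: image_nonempty.
  - exact: finD.
  - by rewrite bigcup_image.
  - by apply: (sF Y FY); apply: entails_mono Da.
exists (Gamma `|` T); first by left.
split=> // b nb; apply: contrapT; rewrite -setUA; apply: maxT.
by split=> [c|sT]; [left|apply: nb; right; apply: sT; right].
Qed.

Lemma relatively_maximal_theory (L : logic) a T :
  relatively_maximal L a T -> theory L T.
Proof.
move=> [nTa maxT] b Tb; apply: contrapT => /maxT Tba; apply: nTa.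
by apply: entails_cut Tba => c [Tc|->//]; apply: entails_refl.
Qed.

Section BD1Extensions.
Variable L : logic.
(* Weaker than [extension_of BD1 L] and inherited by finitary parts, without
   any need to know that BD1 is finitary. *)
Hypothesis L_ext : extension_of (finitary_part BD1) L.

Lemma dm_le_entails a b : dm_le a b -> L [set a] b.
Proof.
move=> ab; apply: L_ext; exists [set a]; split=> //.
exact: BD1_dm_le.
Qed.

Lemma theory_filter T : theory L T -> meet_filter dm_le And T.
Proof.
move=> theoryT; split=> [a b Ta ab|a b Ta Tb]; apply: theoryT.
  by apply: entails_mono (dm_le_entails ab) => _ ->.
apply: L_ext; exists [set a; b]; split; [|by move=> _ [->|->]|exact: BD1_And].
exact: finite_set2.
Qed.

Lemma relatively_maximal_nprime n a T :
  0 < n -> PCP n L -> relatively_maximal L a T -> nprime dm_le n T.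
Proof.
move=> n_gt0 L_PCP maxT phi sT; apply: contrapT => /forallNP nT.
set all := bigOr [seq phi j | j <- enum 'I_n.+1].
have Tall : T all.
  by apply: sT => i _; apply: dm_le_bigOr; rewrite mem_enum.
apply: maxT.1; apply: (@entails_cut _ _ (T `|` [set all])) => [b Tb|].
  by apply: entails_refl; case: Tb => [//|->].
apply: L_PCP => i; have [u [ub nTu]] := nonsubset (nT i).
apply: entails_cut (maxT.2 u nTu) => c [Tc|->].
  by apply: entails_refl; left.
apply: (@entails_mono _ [set bigOr [seq phi j | j <- enum 'I_n.+1 & j != i]]).
  by move=> _ ->; right.
apply: dm_le_entails; apply: bigOr_dm_le => [|j].
  rewrite -has_filter; apply/hasP; exists (lift i (Ordinal n_gt0)).
    by rewrite mem_enum.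
  by rewrite eq_sym neq_lift.
by rewrite mem_filter => /andP[/eqP ji _]; apply: ub.
Qed.

Theorem PCP_countermodel n Gamma a :
  0 < n -> finitary_logic L -> PCP n L -> ~ L Gamma a ->
  exists h : 'I_n -> formula_algebra -> DM4,
    [/\ forall i, homomorphism (h i),
        forall i, h i @` Gamma `<=` designated (s := DM4),
        exists i, ~ designated (s := DM4) (h i a) &
        theory L [set b | forall i, designated (s := DM4) (h i b)]].
Proof.
move=> n_gt0 finL L_PCP nGa.
have [T GT maxT] := relatively_maximal_exists finL nGa.
have theoryT := relatively_maximal_theory maxT.
have [h h_hom TE] := nprime_DM4_preimage n_gt0 (theory_filter theoryT)
  (relatively_maximal_nprime n_gt0 L_PCP maxT).
exists h; split=> //; last by rewrite -TE.
- by move=> i _ [b /GT + <-]; rewrite TE; apply.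
- apply: contrapT => /forallNP ha; apply: maxT.1; apply: entails_refl.
  by rewrite TE => i; apply: contrapT; apply: ha.
Qed.

End BD1Extensions.

(** * Compactness of finite structures *)

Lemma ultrafilter_finite_fiber (T M : Type) (U : set_system T) (f : T -> M) :
  UltraFilter U -> finite_set [set: M] -> exists m, U (f @^-1` [set m]).
Proof.
elim/Pchoice: M => M in f * => UU /finite_fsetP[X MX].
apply: contrapT => /forallNP nU.
have /filter_ex[x fx] : U (\bigcap_(m in [set` X]) ~` (f @^-1` [set m])).
  apply: filter_bigI => m _.
  by have [/nU|] := in_ultra_setVsetC (f @^-1` [set m]) UU.
by apply: (fx (f x)) => //; rewrite -MX.
Qed.

Lemma ultralimit_hom (A B : algebra) (U : set_system (A -> B)) :
  UltraFilter U -> finite_set [set: B] -> U (@homomorphism A B) ->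
  exists2 u, homomorphism u & forall x, U [set v | v x = u x].
Proof.
move=> UU finB U_hom; have /choice[u uU] x : exists b, U [set v | v x = b].
  exact: ultrafilter_finite_fiber.
have near_u x y z : exists v : A -> B,
    homomorphism v /\ [/\ v x = u x, v y = u y & v z = u z].
  have [v [v_hom [vx [vy vz]]]] :=
    filter_ex (filterI U_hom (filterI (uU x) (filterI (uU y) (uU z)))).
  by exists v.
exists u => //; split=> [x y|x y|x].
- by have [v [[vI _ _] [<- <- <-]]] := near_u x y (ameet x y).
- by have [v [[_ vU _] [<- <- <-]]] := near_u x y (ajoin x y).
- by have [v [[_ _ vN] [<- _ <-]]] := near_u x x (aneg x).
Qed.

(* A limit of countermodels of the finite subsets of Gamma along an ultrafilter
   is a countermodel of Gamma. *)
Lemma finite_structure_compact (M : structure) (Gamma : set formula) a :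
  finite_structure M -> valid M Gamma a ->
  exists Delta, [/\ finite_set Delta, Delta `<=` Gamma & valid M Delta a].
Proof.
move=> finM Ga; apply: contrapT => noD.
pose countermodels Delta := [set v : formula_algebra -> M |
  [/\ homomorphism v, v @` Delta `<=` designated (s := M) &
      ~ designated (s := M) (v a)]].
pose D := [set Delta | finite_set Delta /\ Delta `<=` Gamma].
have /ultraFilterLemma[U [UU FU]] : ProperFilter (filter_from D countermodels).
  apply: filter_from_proper => [|Delta [finD sD]].
    apply: filter_from_filter; first by exists set0; split.
    move=> D1 D2 [fin1 s1] [fin2 s2]; exists (D1 `|` D2).
      by split; [rewrite finite_setU|rewrite subUset].
    by move=> v [v_hom + nva]; rewrite image_setU subUset => -[v1 v2].
  apply: contrapT => /forallNP nv; apply: noD.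
  exists Delta; split=> // v v_hom vD.
  by apply: contrapT => nva; apply: (nv v).
have U0 : U (countermodels set0) by apply: FU; exists set0 => //; split.
have [|u u_hom uU] := ultralimit_hom UU finM.
  by apply: filterS U0 => v [].
have : designated (u a).
  apply: (Ga u u_hom) => _ [b Gb <-].
  have Ub : U (countermodels [set b]).
    by apply: FU; exists [set b] => //; split=> [|_ ->].
  have [v [[_ vb _] <-]] := filter_ex (filterI Ub (uU b)).
  by apply: vb; exists b.
by have [v [[_ _ nva] <-] /nva] := filter_ex (filterI U0 (uU a)).
Qed.

Lemma finitely_generated_finitary (L : logic) :
  finitely_generated L -> finitary_logic L.
Proof.
case=> K [finK finM LK] Gamma a /LK Ga.
have /choice[D hD] M : exists Delta, K M ->
    [/\ finite_set Delta, Delta `<=` Gamma & valid M Delta a].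
  have [KM|nKM] := pselect (K M); last by exists set0.
  have [Delta hD] := finite_structure_compact (finM M KM) (Ga M KM).
  by exists Delta.
exists (\bigcup_(M in K) D M); split.
- by apply: bigcup_finite => // M /hD[].
- by apply: bigcup_sub => M /hD[].
- apply/LK => M KM v v_hom vD; have [_ _] := hD M KM; apply=> //.
  by apply: subset_trans vD; apply/image_subset/bigcup_sup.
Qed.

(** * Rules refuted in subsets of powers *)

(* An M^I-valued homomorphism is a family of M-valued ones. If B is a subalgebra
   of M^I, then r is refuted in B if it is not valid in the substructure of M^I
   with universe B. *)
Definition refuted_in (I : Type) (M : structure) (B : set (I -> M)) (r : rule) :
    Prop :=
  exists v : I -> formula_algebra -> M,
    [/\ forall i, homomorphism (v i), forall a, B (v^~ a),
        forall i, v i @` r.1 `<=` designated (s := M) &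
        exists i, ~ designated (s := M) (v i r.2)].

Lemma finite_set_fun (I T : Type) :
  finite_set [set: I] -> finite_set [set: T] -> finite_set [set: I -> T].
Proof.
elim/Pchoice: I => I; elim/Pchoice: T => T.
move=> /finite_fsetP[X IX] /finite_fsetP[Y TY].
have inX i : i \in X by have : [set` X] i by rewrite -IX.
have inY y : y \in Y by have : [set` Y] y by rewrite -TY.
suff -> : [set: I -> T] =
    range (fun (g : {ffun X -> Y}) i => val (g [` inX i]%fset)).
  exact: finite_image.
apply/seteqP; split=> // f _; exists [ffun i => [` inY (f (val i))]%fset] => //.
by apply/funext => i; rewrite ffunE.
Qed.

Lemma finite_set_Prop : finite_set [set: Prop].
Proof.
suff -> : [set: Prop] = [set True; False] by exact: finite_set2.
apply/seteqP; split=> // P _.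
by have [/propT->|/propF->] := pselect P; [left|right].
Qed.

Lemma finite_refuting_rules (I : Type) (M : structure) (L : logic) :
  finite_set [set: I] -> finite_structure M -> finitary_logic L ->
  exists R : set rule,
    [/\ finite_set R, forall r, R r -> finitary r, validates L R &
        forall (B : set (I -> M)) s, L s.1 s.2 -> refuted_in B s ->
          exists2 r, R r & refuted_in B r].
Proof.
move=> finI finM finL.
have /choice[r hr] (B : set (I -> M)) : exists r : rule,
    [/\ finitary r, L r.1 r.2 &
        forall s, L s.1 s.2 -> refuted_in B s -> refuted_in B r].
  have [[r [finr Lr rB]]|nr] := pselect (exists r : rule,
    [/\ finitary r, L r.1 r.2 & refuted_in B r]); first by exists r.
  exists ([set Var 0], Var 0); split; first exact: finite_set1.
    exact: entails_refl.
  move=> s /finL[D [finD Ds Ls]] [v [v_hom vB vs nvs]]; case: nr.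
  exists (D, s.2); split=> //; exists v; split=> // i.
  by apply: subset_trans (vs i); apply: image_subset.
exists (range r); split=> [|_ [B _ <-]|_ [B _ <-]|B s Ls sB].
- apply/finite_image/finite_set_fun; first exact: finite_set_fun.
  exact: finite_set_Prop.
- by have [] := hr B.
- by have [] := hr B.
- by exists (r B) => //; have [_ _] := hr B; apply; first exact: Ls.
Qed.

Fixpoint subst (sigma : nat -> formula) (a : formula) : formula :=
  match a with
  | Var k => sigma k
  | And b c => And (subst sigma b) (subst sigma c)
  | Or b c => Or (subst sigma b) (subst sigma c)
  | Neg b => Neg (subst sigma b)
  end.

Lemma hom_subst (A : algebra) (h v : formula_algebra -> A) sigma :
  homomorphism h -> homomorphism v -> (forall k, h (sigma k) = v (Var k)) ->
  forall a, h (subst sigma a) = v a.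
Proof.
move=> [hI hU hN] [vI vU vN] hv; elim=> //= [b IHb c IHc|b IHb c IHc|b IHb].
- by rewrite hI vI IHb IHc.
- by rewrite hU vU IHb IHc.
- by rewrite hN vN IHb.
Qed.

Lemma theory_not_refuted (L : logic) (I : Type) (M : structure)
    (h : I -> formula_algebra -> M) (r : rule) :
  (forall i, homomorphism (h i)) ->
  theory L [set a | forall i, designated (s := M) (h i a)] -> L r.1 r.2 ->
  ~ refuted_in (range (fun a => h^~ a)) r.
Proof.
move=> h_hom theory_h Lr [v [v_hom vh vr [i nvr]]]; apply: nvr.
have /choice[sigma hsigma] k : exists a, h^~ a = v^~ (Var k).
  by have [a _ ha] := vh (Var k); exists a.
have hv j a : h j (subst sigma a) = v j a.
  by apply: hom_subst => // k; have := congr1 (@^~ j) (hsigma k).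
rewrite -hv; move: i; apply: theory_h.
apply: entails_mono (@entails_subst L (subst sigma) _ _ _ Lr); last by split.
by move=> _ [b rb <-] j /=; rewrite hv; apply: vr; exists b.
Qed.

Lemma finite_DM4 : finite_structure DM4.
Proof. exact: (@finite_finset (bool * bool)%type). Qed.

Theorem mainTheorem14 (n : nat) (hn : (1 <= n)%N) (L : logic)
    (L_fg : finitely_generated L) (L_ext : extension_of BD1 L) (L_PCP : PCP n L) :
  exists R : set rule,
    [/\ finite_set R,
        forall r, R r -> finitary r &
        smallest_logic
          [set L' : logic | [/\ extension_of BD1 L', PCP n L' & validates L' R]] L].
Proof.
have [R [finR R_finitary LR R_refutes]] :=
  finite_refuting_rules (@finite_finset 'I_n _) finite_DM4
    (finitely_generated_finitary L_fg).
exists R; split=> //; split=> // L' [L'_ext L'_PCP L'R] Gamma a LGa.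
apply: finitary_part_sub; apply: contrapT => nGa.
have [h [h_hom hG ha h_theory]] := PCP_countermodel
  (finitary_part_extension L'_ext) hn (@finitary_finitary_part L')
  (PCP_finitary_part L'_PCP) nGa.
have [|r Rr] := R_refutes (range (fun b => h^~ b)) (Gamma, a) LGa.
  by exists h; split=> // b; exists b.
apply: (theory_not_refuted h_hom h_theory).
by exists r.1; split=> //; [exact: R_finitary|exact: L'R].
Qed.
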